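(* For each $n\ge1$ let $d_1^{(n)},\dots,d_n^{(n)}$ be non-negative integers with even sum, let $G^*_{n}=G^*\bigl(n,(d_i^{(n)})_{i=1}^n\bigr)$ be the random multigraph given by the configuration model, and let $N=N_n=\tfrac12\sum_{i=1}^n d_i^{(n)}$. Assume that $N_n=\Theta(n)$ as $n\to\infty$. Then, as $n\to\infty$: (i) $\liminf_{n\to\infty}\mathbb P(G^*_n\text{ is simple})>0$ if and only if $\sum_{i=1}^n (d_i^{(n)})^2=O(n)$; (ii) $\mathbb P(G^*_n\text{ is simple})\to0$ if and only if $\sum_{i=1}^n (d_i^{(n)})^2/n\to\infty$.
   Context: Configuration model: given $n\ge1$ and non-negative integers $d_1,\dots,d_n$ with $\sum_i d_i=2N$ even, take pairwise disjoint sets of half-edges, with $d_v$ half-edges belonging to each vertex $v\in\{1,\dots,n\}$ ($2N$ half-edges in total). A configuration is a partition of the set of all half-edges into $N$ pairs. Choose a configuration uniformly at random; $G^*(n,(d_i)_1^n)$ is the random multigraph with vertex set $\{1,\dots,n\}$ in which each pair $\{x,y\}$ of the configuration, with $x$ belonging to $v$ and $y$ belonging to $w$, gives an edge between $v$ and $w$ (a loop if $v=w$). A multigraph is simple if it has no loops and no multiple edges. $A=\Theta(B)$ means that both $A=O(B)$ and $B=O(A)$ hold. *)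

(* Defs.v *)
From HB Require Import structures.
From mathcomp Require Import all_boot all_order all_algebra.
From mathcomp Require Import all_classical all_reals all_analysis.
Set Implicit Arguments.
Unset Strict Implicit.
Unset Printing Implicit Defensive.
Import Order.TTheory GRing.Theory Num.Theory.
Import numFieldNormedType.Exports.

Local Open Scope nat_scope.

(* [ends e] is the set of endpoints of the edge [e]: a loop has exactly one
   endpoint, any other edge has exactly two. *)
Record multigraph (V : finType) := Multigraph {
  edge : finType;
  ends : edge -> {set V};
  ends_card : forall e, 0 < #|ends e| <= 2 }.

Definition is_loop (V : finType) (G : multigraph V) (e : edge G) : bool :=
  #|ends e| == 1.

Definition parallel (V : finType) (G : multigraph V) (e f : edge G) : bool :=
  (e != f) && (ends e == ends f).

Definition simple_multigraph (V : finType) (G : multigraph V) : bool :=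
  [forall e : edge G, ~~ is_loop e] &&
  [forall e : edge G, forall f : edge G, ~~ parallel e f].

Section ConfigurationModel.
Variables (n : nat) (d : 'I_n -> nat).

(* The half-edges at [v] are the elements whose tag is [v]. *)
Definition half_edge : finType := {v : 'I_n & 'I_(d v)}.

Definition is_configuration (c : {set {set half_edge}}) : bool :=
  finset.partition c [set: half_edge] && [forall B in c, #|B| == 2].

Definition configuration : finType :=
  {c : {set {set half_edge}} | is_configuration c}.

Definition config_edge (c : configuration) : finType :=
  {B : {set half_edge} | B \in val c}.

Definition config_ends (c : configuration) (e : config_edge c) : {set 'I_n} :=
  [set tag x | x in val e].

Lemma config_ends_card (c : configuration) (e : config_edge c) :
  0 < #|config_ends e| <= 2.
Proof.
case: e => B /= Bc; case/andP: (valP c) => _ /forall_inP/(_ B Bc)/eqP B2.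
rewrite /config_ends /= -[X in _ && (_ <= X)]B2 leq_imset_card andbT card_gt0.
have /set0Pn[x xB] : B != finset.set0 by rewrite -card_gt0 B2.
by apply/set0Pn; exists (tag x); apply: imset_f.
Qed.

Definition config_multigraph (c : configuration) : multigraph 'I_n :=
  Multigraph (@config_ends_card c).

End ConfigurationModel.

Definition equiprob (R : realType) (T : finType) (A : {set T}) : R :=
  (#|A|%:R / #|T|%:R)%R.

Definition prob_simple (R : realType) (n : nat) (d : 'I_n -> nat) : R :=
  equiprob R
    [set c : configuration d | simple_multigraph (config_multigraph c)].

(* Halving is exact when the sum of the degrees is even. *)
Definition num_edges (n : nat) (d : 'I_n -> nat) : nat := (\sum_(i < n) d i)./2.

Definition sum_sq_deg (n : nat) (d : 'I_n -> nat) : nat :=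
  \sum_(i < n) d i ^ 2.

Section Asymptotics.
Variable R : realType.
Local Open Scope classical_set_scope.
Local Open Scope ring_scope.

Definition bigO_nat (a b : nat -> nat) : Prop :=
  (fun n => (a n)%:R : R) =O_\oo (fun n => (b n)%:R : R).

Definition Theta_nat (a b : nat -> nat) : Prop := bigO_nat a b /\ bigO_nat b a.

End Asymptotics.

(* Main.v *)
Require Import Defs.
From mathcomp Require Import all_boot all_order all_algebra.
From mathcomp Require Import all_classical all_reals all_analysis.
From mathcomp Require Import perm fintype finset.
From mathcomp Require Import ring lra.
Import Order.TTheory GRing.Theory Num.Theory.
Import numFieldNormedType.Exports.

(** Let [h = 2 N] be the number of half-edges and [Q] the sum of the squared
    degrees. As [N = Theta(n)], the condition [Q = O(n)] means that [Q / h] is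
    bounded and [Q / n -> oo] means that [Q / h] tends to infinity. Both
    equivalences then follow from two bounds on the probability [P] that a single
    degree sequence gives a simple multigraph: if [Q <= C h] and [h] is large, then
    [P] is at least a positive constant that depends only on [C]
    ([prob_simple_ge]); if [h] and [Q / h] are large, then [P] is small
    ([prob_simple_le]).

    For the upper bound, loops suffice. There are [L = Q - h] ordered pairs of
    distinct half-edges at a common vertex. One such pair belongs to the
    configuration with probability [1 / (h - 1)], and two disjoint ones with
    probability [1 / ((h - 1) (h - 3))]. So the number of loops, each counted
    twice, has mean [mu = L / (h - 1)] and variance at most
    [2 mu + 2 mu ^ 2 / (h - 3)], and by Chebyshev's inequality it vanishes with
    probability at most [2 / mu + 2 / (h - 3)].

    For the lower bound, call a loop or two parallel edges an obstruction. The
    expected number of obstructions is bounded in terms of [C], and if they were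
    independent, avoiding them all would have probability bounded below. The
    lopsided form of the Lovasz local lemma ([local_lemma]) gives the same
    conclusion under two conditions. First, an obstruction is not likelier than its
    weight when one conditions on the absence of any obstructions disjoint from it
    ([lopsided_occurrences]). This holds because exchanging the partner of one of
    its half-edges is injective on configurations and creates no obstruction
    disjoint from it ([swap_count], [avoid_stable]). Second, the obstructions that
    meet a given one have small total weight ([sum_conflict]): those through a
    half-edge at [v] weigh [O(d v / h)], and [d v <= sqrt Q = O(sqrt h)]. *)

Set Implicit Arguments.
Unset Strict Implicit.
Unset Printing Implicit Defensive.
Local Open Scope nat_scope.

(** * Configurations and exchanges of partners *)

Section Pairing.
Variables (n : nat) (d : 'I_n -> nat).
Local Notation H := (half_edge d).
Local Notation T := (configuration d).
Implicit Types (c : T) (x y z : H) (E : {set T}).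

Definition paired c x y : bool := [set x; y] \in val c.

Lemma pairedC c x y : paired c x y = paired c y x.
Proof. by rewrite /paired setUC. Qed.

Lemma card_block c (B : {set H}) : B \in val c -> #|B| = 2.
Proof.
by move=> cB; case/andP: (valP c) => _ /forall_inP/(_ B cB)/eqP.
Qed.

Lemma paired_neq c x y : paired c x y -> x != y.
Proof. by move=> /card_block; rewrite cards2; case: eqP. Qed.

Lemma block_inj c (B C : {set H}) x :
  B \in val c -> C \in val c -> x \in B -> x \in C -> B = C.
Proof.
move=> cB cC xB xC; case/andP: (valP c) => /and3P[_ tI _] _.
by rewrite -(def_pblock tI cB xB) (def_pblock tI cC xC).
Qed.

Lemma paired_inj c x y z : paired c x y -> paired c x z -> y = z.
Proof.
move=> xy xz; have := block_inj xy xz (set21 x y) (set21 x z).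
move/setP/(_ y); rewrite set22 in_set2 eq_sym => /esym/orP[] /eqP // yx.
by move: (paired_neq xy); rewrite yx eqxx.
Qed.

Lemma block_paired c (B : {set H}) : B \in val c ->
  exists x y, B = [set x; y] /\ paired c x y.
Proof.
move=> cB; have /eqP/cards2P[x [y [_ def_B]]] := card_block cB.
by exists x, y; rewrite /paired -def_B.
Qed.

Lemma paired_ex c x : exists y, paired c x y.
Proof.
case/andP: (valP c) => /and3P[/eqP cov _ _] _.
have : x \in cover (val c) by rewrite cov in_setT.
case/bigcupP => B /block_paired[u [v [-> uv]]].
rewrite in_set2 => /orP[]/eqP ->; first by exists v.
by exists u; rewrite pairedC.
Qed.

Lemma relabel_subproof (s : {perm H}) c :
  is_configuration [set s @: (B : {set H}) | B in val c].
Proof.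
case/andP: (valP c) => /and3P[/eqP cov tI s0] /forall_inP c2.
apply/andP; split; last first.
  apply/forall_inP => _ /imsetP[B cB ->].
  by rewrite card_imset ?c2 //; exact: perm_inj.
apply/and3P; split.
- apply/eqP/setP => x; rewrite in_setT; apply/bigcupP.
  have : (s^-1)%g x \in cover (val c) by rewrite cov in_setT.
  case/bigcupP => B cB xB; exists (s @: B); first exact: imset_f.
  by rewrite -[x](permKV s) imset_f.
- apply/trivIsetP => _ _ /imsetP[B cB ->] /imsetP[C cC ->] neq.
  rewrite -setI_eq0 -imsetI; last by move=> ? ? _ _; exact: perm_inj.
  have BC : B != C by apply: contraNneq neq => ->.
  by move/trivIsetP: tI => /(_ _ _ cB cC BC); rewrite -setI_eq0 => /eqP->; rewrite imset0.
- apply: contra s0 => /imsetP[B cB /esym/eqP]; rewrite imset_eq0 => /eqP B0.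
  by rewrite -B0.
Qed.

Definition relabel (s : {perm H}) c : T :=
  exist (@is_configuration _ d) _ (relabel_subproof s c).

Lemma paired_relabel (s : {perm H}) c x y :
  paired (relabel s c) (s x) (s y) = paired c x y.
Proof.
rewrite /paired /= -!imset_set1 -imsetU.
by rewrite mem_imset //; apply: imset_inj; exact: perm_inj.
Qed.

Lemma relabel_inj (s : {perm H}) : injective (relabel s).
Proof.
move=> b c /(congr1 val) /= bc; apply: val_inj.
by move/imset_inj: bc; apply; apply: imset_inj; exact: perm_inj.
Qed.

(** Exchanges the partners of [y] and [z]. *)
Definition swap y z := relabel (tperm y z).

Lemma paired_swap c x y z :
  z != x -> paired c x y -> paired (swap y z c) x z.
Proof.
move=> zx xy; have xy' := paired_neq xy.
by rewrite /swap -{2}(tpermL y z) -[x](@tpermD _ y z) ?paired_relabel // eq_sym.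
Qed.

(** Besides the pair [x z], the swap only creates the pair formed by [y] and the
    former partner of [z], so away from [x] and [y] every pair of the new
    configuration was already there. *)
Lemma paired_swap_off c x y z a b : paired c x y ->
    a \notin [set x; y] -> b \notin [set x; y] ->
  paired (swap y z c) a b -> paired c a b.
Proof.
move=> xy; rewrite !in_set2 !negb_or => /andP[ax ay] /andP[bx b_y].
rewrite -{1}(tpermK y z a) -{1}(tpermK y z b) paired_relabel.
have yx : paired c y x by rewrite pairedC.
have aux w : w != x -> w != y -> paired c y w -> False.
  by move=> wx wy yw; move: wx; rewrite (paired_inj yx yw) eqxx.
have [->|az] := eqVneq a z.
  have [->|bz] := eqVneq b z; first by rewrite tpermR => /paired_neq; rewrite eqxx.
  by rewrite tpermR tpermD 1?eq_sym// => /aux; case.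
have [->|bz] := eqVneq b z.
  by rewrite tpermR tpermD 1?eq_sym// pairedC => /aux; case.
by rewrite !tpermD // eq_sym.
Qed.

Lemma paired_swap_on c x y z a b :
    a \notin [set y; z] -> b \notin [set y; z] ->
  paired (swap y z c) a b = paired c a b.
Proof.
rewrite !in_set2 !negb_or => /andP[ax ay] /andP[bx b_y].
by rewrite -{1}(@tpermD _ y z a) 1?eq_sym// -{1}(@tpermD _ y z b) 1?eq_sym// paired_relabel.
Qed.

Lemma card_paired_le x y z : z != x ->
  #|[set c | paired c x y]| <= #|[set c | paired c x z]|.
Proof.
move=> zx; rewrite -(card_imset _ (@relabel_inj (tperm y z))).
apply: subset_leq_card; apply/subsetP => _ /imsetP[c cD ->].
by move: cD; rewrite !inE => /(paired_swap zx).
Qed.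

Lemma sum_paired c x : \sum_z (paired c x z : nat) = 1.
Proof.
have [y xy] := paired_ex c x.
rewrite (bigD1 y) //= xy big1 // => z zy.
by case: (boolP (paired c x z)) => // /(paired_inj xy) yz; rewrite yz eqxx in zy.
Qed.

Lemma sum_card_paired E x : \sum_z #|[set c in E | paired c x z]| = #|E|.
Proof.
transitivity (\sum_z \sum_(c in E) (paired c x z : nat)).
  by apply: eq_bigr => z _; rewrite -sum1dep_card big_mkcondr.
by rewrite exchange_big /= -sum1_card; apply: eq_bigr => c _; exact: sum_paired.
Qed.

(** Swapping [y] with [z] injects the members of [E] that pair [x] with [y] into
    those that pair [x] with [z]. The latter sets are disjoint for distinct [z],
    so the former takes up at most a fraction [1 / (#|H| - #|U|)] of [E]. *)
Lemma swap_count E x y (U : {set H}) : x \in U ->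
    (forall c z, c \in E -> paired c x y -> z \notin U -> swap y z c \in E) ->
  (#|H| - #|U|) * #|[set c in E | paired c x y]| <= #|E|.
Proof.
move=> xU stab; rewrite -(sum_card_paired E x) -cardsT -cardsDS ?subsetT//.
rewrite -sum_nat_const [leqRHS](bigID (mem ([set: H] :\: U)))/=.
apply: leq_trans (leq_addr _ _); apply: leq_sum => z.
rewrite in_setD in_setT andbT => zU.
rewrite -(card_imset _ (@relabel_inj (tperm y z))).
apply: subset_leq_card; apply/subsetP => _ /imsetP[c cD ->].
move: cD; rewrite !inE => /andP[cE cxy]; rewrite stab //=.
by apply: paired_swap => //; apply: contraNneq zU => ->.
Qed.

(** [E] is not left when the partner [y] of [x] is exchanged for another one. *)
Definition stable E x y :=
  forall c z, c \in E -> paired c x y -> z != x -> swap y z c \in E.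

Lemma card_pair E x y : stable E x y ->
  (#|H| - 1) * #|[set c in E | paired c x y]| <= #|E|.
Proof.
move=> st; rewrite -(cards1 x); apply: swap_count; rewrite ?set11//.
by move=> c z cE xy; rewrite in_set1 => zx; exact: st.
Qed.

(** The bound of [swap_count] applies twice. Once [x] and [y] are paired, the
    partner of [x'] can still be exchanged for any half-edge other than [x], [y]
    and [x'] without breaking the pair [x y]: hence the factor [#|H| - 3]. *)
Lemma card_pair2 E x y x' y' : stable E x y -> stable E x' y' ->
    x' != x -> x' != y ->
  (#|H| - 1) * (#|H| - 3) *
    #|[set c in E | paired c x y && paired c x' y']| <= #|E|.
Proof.
move=> st st' x'x x'y; have := card_pair st; apply: leq_trans.
rewrite -mulnA leq_mul2l; apply/orP; right.
set E1 := [set c in E | paired c x y].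
have -> : [set c in E | paired c x y && paired c x' y'] =
          [set c in E1 | paired c x' y'].
  by apply/setP => c; rewrite !inE andbA.
have [xy|xy] := eqVneq x y.
  suff -> : [set c in E1 | paired c x' y'] = set0 by rewrite cards0 muln0.
  apply/setP => c; rewrite !inE xy; case: (boolP (paired c y y)); rewrite ?andbF//.
  by move/paired_neq; rewrite eqxx.
have cU : #|(x' |: [set x; y])| = 3.
  by rewrite cardsU1 in_set2 negb_or x'x x'y cards2 xy.
have := @swap_count E1 x' y' (x' |: [set x; y]).
rewrite cU; apply; first by rewrite !inE eqxx.
move=> c z; rewrite !inE !negb_or => /andP[cE cxy] cxy'.
move=> /and3P[zx' zx zy]; rewrite st' //=.
(* [x] and [y] are paired with each other, so neither is the partner of [x']. *)
have y'y : y' != y.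
  apply: contraTneq cxy' => ->; rewrite pairedC; apply: contraTN cxy => yx'.
  by rewrite pairedC; apply: contraNN x'x => yx; rewrite (paired_inj yx yx').
have y'x : y' != x.
  apply: contraTneq cxy' => ->; rewrite pairedC; apply: contraTN cxy => xx'.
  by apply: contraNN x'y => yx; rewrite (paired_inj yx xx').
by rewrite paired_swap_on // in_set2 negb_or eq_sym ?y'x ?y'y eq_sym.
Qed.

(** By symmetry all [#|H| - 1] partners of [x] are equally likely. *)
Lemma card_pair_ge x y : x != y ->
  #|T| <= (#|H| - 1) * #|[set c | paired c x y]|.
Proof.
move=> xy; rewrite -cardsT -(sum_card_paired [set: T] x) (bigD1 x) //=.
have -> : #|[set c in [set: T] | paired c x x]| = 0.
  apply/eqP; rewrite cards_eq0; apply/eqP/setP => c; rewrite !inE.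
  by apply/negP => /paired_neq; rewrite eqxx.
rewrite add0n subn1 -(cardC1 x) -sum_nat_const; apply: leq_sum => z zx.
have -> : [set c in [set: T] | paired c x z] = [set c | paired c x z].
  by apply/setP => c; rewrite !inE.
by apply: card_paired_le; rewrite eq_sym.
Qed.

Lemma card_half_edge : #|H| = \sum_i d i.
Proof.
rewrite card_tagged sumnE big_map big_enum; by apply: eq_bigr => i _; rewrite card_ord.
Qed.

(** Number the half-edges and pair the ranks [2 k] and [2 k + 1]. Without a
    configuration the quotient [equiprob] would be [0]. *)
Lemma configuration_ex : ~~ odd #|H| -> 0 < #|T|.
Proof.
move=> even; pose f x := (enum_rank x)./2.
have pP := preim_partitionP f [set: H].
have flip_lt (x : H) :
    (if odd (enum_rank x) then (enum_rank x).-1 else (enum_rank x).+1) < #|H|.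
  have := ltn_ord (enum_rank x); case: ifP => [_|].
    by apply: leq_ltn_trans; exact: leq_pred.
  move=> ox; rewrite leq_eqVlt => /orP[/eqP eH|//].
  by rewrite -eH /= ox in even.
pose g x := enum_val (Ordinal (flip_lt x)).
suff cP : is_configuration (preim_partition f [set: H]).
  by apply/card_gt0P; exists (exist (@is_configuration _ d) _ cP).
apply/andP; split=> //; apply/forall_inP => B /imsetP[x _ ->].
suff -> : [set y in [set: H] | f x == f y] = [set x; g x].
  rewrite cards2; case: (x =P g x) => // /(congr1 (@enum_rank H)).
  rewrite enum_valK => /(congr1 val)/=; case: ifP => [|_ /eqP]; last by rewrite ltn_eqF.
  by case: (nat_of_ord _) => //= m _ /eqP; rewrite gtn_eqF.
apply/setP => y; rewrite !inE /= /f -(inj_eq (@enum_rank_inj _) y x).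
rewrite -(inj_eq (@enum_rank_inj _) y (g x)) /g enum_valK -!val_eqE /=.
move: (nat_of_ord (enum_rank x)) (nat_of_ord (enum_rank y)) => a b.
have := odd_double_half a; have := odd_double_half b.
move: (odd a) (odd b) => oa ob defb defa; apply/idP/idP.
  move=> /eqP ab; rewrite -defa -defb ab.
  by case: oa ob {defa defb} => -[] /=; rewrite ?eqxx ?orbT.
case/orP => /eqP ->//; rewrite -defa.
by case: oa {defa defb}; rewrite /= ?add1n ?add0n /= ?uphalf_double ?doubleK.
Qed.

End Pairing.

(** * The lopsided local lemma *)

Section LocalLemma.
Local Open Scope ring_scope.
Variables (R : realType) (T I : finType) (A : I -> {set T}) (p : I -> R).
Variable conflict : rel I.
Implicit Types (i j : I) (S : {set I}).

Definition avoid S : {set T} := (\bigcap_(j in S) ~: A j).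

Hypothesis p_ge0 : forall i, 0 <= p i.
Hypothesis conflict_refl : reflexive conflict.
(** Independence is replaced by a one-sided bound: avoiding events that do not
    conflict with [i] does not make [A i] likelier than [p i]. *)
Hypothesis lopsided : forall i S, (forall j, j \in S -> ~~ conflict i j) ->
  #|(A i :&: avoid S)|%:R <= p i * #|avoid S|%:R.
Hypothesis small : forall i, \sum_(j | conflict i j) p j <= 4^-1.

Lemma avoidU1 j S : avoid (j |: S) = (avoid S :\: A j).
Proof. by rewrite /avoid bigcap_setU big_set1 setDE setIC. Qed.

Lemma p_le i : p i <= 4^-1.
Proof.
apply: le_trans (small i); rewrite (bigD1 i) //= lerDl; exact: sumr_ge0.
Qed.

(** A union bound: the events of [S'] together cover at most the fraction
    [2 * 4^-1] of [avoid S], because they all conflict with [i]. *)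
Lemma avoid_half i S S' :
    (forall j, j \in S' -> conflict i j /\ #|(A j :&: avoid S)|%:R <= 2 * p j * #|avoid S|%:R) ->
  (#|avoid S|%:R : R) <= 2 * #|avoid (S :|: S')|%:R.
Proof.
move=> HS'.
have sub : (avoid S \subset avoid (S :|: S') :|: \bigcup_(j in S') (A j :&: avoid S)).
  apply/subsetP => t tS; rewrite in_setU; case: (boolP (t \in avoid _)) => //= tN.
  move: tN; rewrite /avoid bigcap_setU in_setI -/(avoid S) tS /=.
  case: (boolP (t \in \bigcup_(j in S') (A j :&: avoid S))) => // tN /negP[].
  apply/bigcapP => j jS'; rewrite in_setC; apply: contraNN tN => tA.
  by apply/bigcupP; exists j => //; rewrite in_setI tA.
have le1 : (#|avoid S| <= #|avoid (S :|: S')| + \sum_(j in S') #|(A j :&: avoid S)|)%N.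
  apply: leq_trans (subset_leq_card sub) _; apply: leq_trans (leq_card_setU _ _) _.
  rewrite leq_add2l.
  elim/big_rec2: _ => [|j m B _ IH]; first by rewrite cards0.
  by apply: leq_trans (leq_card_setU _ _) _; rewrite leq_add2l.
have le2 : (\sum_(j in S') #|(A j :&: avoid S)|)%:R <= 2^-1 * (#|avoid S|%:R : R).
  rewrite natr_sum; apply: (@le_trans _ _ (\sum_(j in S') 2 * p j * #|avoid S|%:R)).
    by apply: ler_sum => j /HS'[].
  rewrite -mulr_suml -mulr_sumr; apply: ler_wpM2r => //.
  have : \sum_(j in S') p j <= 4^-1.
    apply: le_trans (small i); rewrite [leRHS]big_mkcond [leLHS]big_mkcond /=; apply: ler_sum => j _.
    case: ifP => [/HS'[-> _]//|_]; by case: ifP.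
  lra.
move: le1; rewrite -(ler_nat R) natrD; lra.
Qed.

(** Conditioning on [avoid S] at most doubles the weight of [A i]. Split [S] into
    the events that conflict with [i] and the others: the others are harmless by
    [lopsided], and the former keep at least half of what the others leave, by
    induction on the size of [S]. *)
Lemma avoid_step i S : #|(A i :&: avoid S)|%:R <= 2 * p i * #|avoid S|%:R.
Proof.
have [m] := ubnP #|S|; elim: m => // m IH in i S *; rewrite ltnS => Sm.
pose S1 := [set j in S | conflict i j]; pose S2 := [set j in S | ~~ conflict i j].
have defS : S = (S2 :|: S1).
  by apply/setP => j; rewrite !inE -andb_orr orNb andbT.
have le1 : (#|(A i :&: avoid S)|%:R : R) <= p i * #|avoid S2|%:R.
  apply: le_trans (lopsided _); last by move=> j; rewrite inE => /andP[].
  rewrite ler_nat; apply: subset_leq_card; apply: setIS.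
  apply/subsetP => t /bigcapP tS; apply/bigcapP => j; rewrite inE => /andP[jS _]; exact: tS.
have le2 : (#|avoid S2|%:R : R) <= 2 * #|avoid S|%:R.
  rewrite [in leRHS]defS; apply: (@avoid_half i) => j; rewrite inE => /andP[jS cij].
  split=> //; apply: IH; apply: leq_trans Sm; apply: proper_card.
  apply/properP; split; first by apply/subsetP => k; rewrite inE => /andP[].
  by exists j => //; rewrite inE jS cij.
by apply: le_trans le1 _; rewrite [2 * p i]mulrC -mulrA ler_wpM2l.
Qed.

Lemma expR_le_1B2 (x : R) : 0 <= x -> x <= 2^-1 -> expR (- (2 * x)) <= 1 - x.
Proof.
move=> x0 x1; have := expR_ge1Dx (2 * x); have := expR_gt0 (2 * x).
rewrite expRN; set e := expR _ => e0 e1.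
rewrite -[leLHS]div1r ler_pdivrMr //.
apply: (@le_trans _ _ ((1 - x) * (1 + 2 * x))); last by apply: ler_wpM2l => //; lra.
have : 0 <= x * (1 - 2 * x) by apply: mulr_ge0 => //; lra.
lra.
Qed.

(** Adding the events one at a time, by [avoid_step] each keeps at least a
    fraction [1 - 2 * p i >= expR (- (4 * p i))] of what is left. *)
Theorem local_lemma (s : seq I) : uniq s ->
  expR (- (4 * \sum_(i <- s) p i)) * #|T|%:R <= #|avoid [set i in s]|%:R.
Proof.
elim: s => [_|i s IH /andP[_ /IH{}IH]].
  rewrite big_nil mulr0 oppr0 expR0 mul1r set_nil /avoid big_set0 cardsT//.
rewrite set_cons avoidU1 big_cons mulrDr opprD expRD -mulrA.
set B := avoid _ in IH *.
have e1 : expR (- (4 * p i)) <= 1 - 2 * p i.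
  have -> : 4 * p i = 2 * (2 * p i) by ring.
  by apply: expR_le_1B2; [have := p_ge0 i; lra | have := p_le i; lra].
apply: (@le_trans _ _ ((1 - 2 * p i) * #|B|%:R)).
  by apply: ler_pM => //; rewrite ?mulr_ge0 ?expR_ge0.
have := avoid_step i [set j in s]; rewrite -/B.
rewrite mulrBl mul1r lerBlDr => /(le_trans _); rewrite -(cardsID (A i) B) setIC natrD addrC.
by move=> h; rewrite lerD2l; exact: h.
Qed.
End LocalLemma.

(** * Obstructions to simplicity *)

Section Obstructions.
Variables (n : nat) (d : 'I_n -> nat).
Local Notation H := (half_edge d).
Local Notation T := (configuration d).
Local Notation h := (\sum_i d i).
Local Notation Q := (sum_sq_deg d).
Implicit Types (c : T) (x y z u : H) (a b : H * H).

Definition same_vertex a : bool := tag a.1 == tag a.2.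

Lemma sum_half_edge (F : 'I_n -> nat) : \sum_(x : H) F (tag x) = \sum_i d i * F i.
Proof.
rewrite -(sig_big_dep xpredT (fun _ => xpredT) (fun i (_ : 'I_(d i)) => F i)) /=.
by apply: eq_bigr => i _; rewrite sum_nat_const card_ord.
Qed.

Lemma sum_tag (v : 'I_n) : \sum_(x : H) (tag x == v : nat) = d v.
Proof.
rewrite (sum_half_edge (fun i => i == v : nat)) (bigD1 v) //= eqxx muln1 big1 ?addn0 // => i iv.
by rewrite (negbTE iv) muln0.
Qed.

Lemma sum_same_vertex : \sum_a (same_vertex a : nat) = Q.
Proof.
rewrite -(pair_bigA _ (fun x y => same_vertex (x, y) : nat)) /=.
rewrite (eq_bigr (fun x : H => d (tag x))) => [|x _]; last first.
  by rewrite -sum_tag; apply: eq_bigr => y _; rewrite /same_vertex eq_sym.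
by rewrite sum_half_edge; apply: eq_bigr.
Qed.

Lemma sum_same_vertex_at u :
  \sum_a (u \in [set a.1; a.2]) * same_vertex a <= 2 * d (tag u).
Proof.
rewrite -(pair_bigA _ (fun x y => (u \in [set x; y]) * same_vertex (x, y))) /=.
apply: (@leq_trans (\sum_x \sum_y ((x == u) * (tag y == tag u) + (y == u) * (tag x == tag u)))).
  apply: leq_sum => x _; apply: leq_sum => y _; rewrite in_set2 /same_vertex /= !(eq_sym _ u).
  case: (eqVneq u x) => [<-|_] /=; first by rewrite [tag y == _]eq_sym mul1n leq_addr.
  by case: (eqVneq u y) => [<-|_].
have sum_eq : \sum_(x : H) (x == u : nat) = 1.
  by rewrite (bigD1 u) //= eqxx big1 // => x /negbTE ->.
under eq_bigr => x _ do
  rewrite big_split /= -big_distrr /= -big_distrl /= sum_eq mul1n sum_tag.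
by rewrite big_split /= -big_distrl /= sum_eq mul1n sum_tag mul2n addnn.
Qed.

Lemma sq_deg_le v : d v ^ 2 <= Q.
Proof. by rewrite /sum_sq_deg (bigD1 v) //= leq_addr. Qed.

(** [inl a] stands for the loop formed by the two half-edges of [a]. [inr (a, b)]
    stands for the parallel edges [a.1 b.1] and [a.2 b.2]: grouping the four
    half-edges by vertex rather than by edge turns sums over such obstructions
    into products. *)
Definition obstruction : finType := (H * H + (H * H) * (H * H))%type.
Implicit Types (i j : obstruction).

Definition support i : {set H} :=
  match i with
  | inl a => [set a.1; a.2]
  | inr (a, b) => [set a.1; a.2] :|: [set b.1; b.2]
  end.

(** The condition on [a.2] makes the two edges of [inr (a, b)] distinct. *)
Definition occurs c i : bool :=
  match i with
  | inl a => same_vertex a && paired c a.1 a.2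
  | inr (a, b) => [&& same_vertex a && same_vertex b,
      a.2 \notin [set a.1; b.1], paired c a.1 b.1 & paired c a.2 b.2]
  end.

Definition occurrences i : {set T} := [set c | occurs c i].

Lemma no_loop_paired c : simple_multigraph (config_multigraph c) ->
  forall x y, tag x = tag y -> ~~ paired c x y.
Proof.
case/andP => /forallP noloop _ x y txy; apply/negP => xy.
move: (noloop (exist (fun B => B \in val c) _ xy)); rewrite /is_loop /= /config_ends /=.
by rewrite imsetU1 imset_set1 cards2 txy eqxx.
Qed.

Lemma simple_of_no_obstruction c : (forall i, ~~ occurs c i) ->
  simple_multigraph (config_multigraph c).
Proof.
move=> no; have noloop x y : paired c x y -> tag x != tag y.
  move=> xy; apply: contraNneq (no (inl (x, y))) => txy.
  by rewrite /= /same_vertex /= xy txy eqxx.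
have nopar x y x' y' : paired c x y -> paired c x' y' ->
    [set x; y] != [set x'; y'] -> tag x = tag x' -> tag y <> tag y'.
  move=> xy xy' neq txx' tyy'; case/negP: (no (inr ((x, x'), (y, y')))).
  rewrite /= /same_vertex /= txx' tyy' !eqxx xy xy' !andbT.
  by apply: contraNN neq => x'xy; apply/eqP/(block_inj xy xy' x'xy); rewrite set21.
apply/andP; split; apply/forallP => -[B /= Bc]; rewrite /is_loop /parallel /=.
  have [x [y [def_B xy]]] := block_paired Bc.
  by rewrite /config_ends /= def_B imsetU1 imset_set1 cards2 noloop.
apply/forallP => -[C /= Cc]; rewrite negb_and negbK -val_eqE /=.
have [//|BC /=] := eqVneq B C.
have [x [y [def_B xy]]] := block_paired Bc.
have [x' [y' [def_C xy']]] := block_paired Cc.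
rewrite /config_ends /= def_B def_C !imsetU1 !imset_set1 in BC *.
apply/eqP => /setP E.
(* As the two edges are not loops, [x'] is at the vertex of [x] and [y'] at that
   of [y], or the other way round. *)
have := E (tag x'); have := E (tag y'); rewrite !inE !eqxx orbT /=.
have := noloop _ _ xy'; case: (eqVneq (tag x') (tag x)) => [e1 ne _ _|_ ne + /= /eqP e1].
  have := E (tag y); rewrite !inE eqxx orbT => /esym/orP[/eqP e2|/eqP e2].
    by have := noloop _ _ xy; rewrite e2 e1 eqxx.
  exact: (nopar _ _ _ _ xy xy').
rewrite -e1 [_ == tag x']eq_sym (negbTE ne) orbF => /eqP e2.
by apply: (nopar x y y' x'); rewrite // 1?pairedC // [in [set y'; x']]setUC.
Qed.

Lemma occurs_off c c' i :
    {in support i &, forall x y, paired c' x y -> paired c x y} ->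
  occurs c' i -> occurs c i.
Proof.
case: i => [a|[a b]] off /=.
  by case/andP => -> /off; apply; rewrite !inE eqxx ?orbT.
case/and4P => -> -> /off p1 /off p2; rewrite p1 ?p2 //; by rewrite !inE eqxx ?orbT.
Qed.

Definition conflict i j : bool := ~~ [disjoint support i & support j].

Lemma conflict_refl : reflexive conflict.
Proof.
move=> i; rewrite /conflict -setI_eq0 setIid; apply/set0Pn.
by case: i => [a|[a b]] /=; exists a.1; rewrite !inE eqxx.
Qed.

(** Exchanging the partner of a half-edge [x] of [i] creates no obstruction that
    is disjoint from [i], because away from [x] and its partner the exchange
    creates no new pair among the half-edges of such an obstruction. *)
Lemma avoid_stable i (S : {set obstruction}) x y :
    (forall j, j \in S -> ~~ conflict i j) ->
    x \in support i -> y \in support i ->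
  stable (avoid occurrences S) x y.
Proof.
move=> cS xi yi c z /bigcapP cE xy _; apply/bigcapP => j jS.
move: (cE j jS); rewrite !inE; apply: contraNN; apply: occurs_off => u w uj wj.
have dij : [disjoint support i & support j] by apply/negbNE/cS.
have off v : v \in support j -> v \notin [set x; y].
  move=> vj; have := disjointFl dij vj; rewrite in_set2.
  by case: eqVneq => [->|_]; [rewrite xi | case: eqVneq => [->|//]; rewrite yi].
exact: paired_swap_off xy (off _ uj) (off _ wj).
Qed.

(** ** The lower bound *)

Section LowerBound.
Variable R : realType.
Local Open Scope ring_scope.
Local Notation hR := (h%:R : R).
Local Notation QR := (Q%:R : R).

(** An upper bound for the probability of [i] in a uniform configuration: one
    given pair occurs with probability [1 / (h - 1)], two given disjoint pairs
    with probability [1 / ((h - 1) (h - 3))]. *)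
Definition weight i : R :=
  match i with
  | inl a => (same_vertex a)%:R / (hR - 1)
  | inr (a, b) => (same_vertex a)%:R * (same_vertex b)%:R / ((hR - 1) * (hR - 3))
  end.

Hypothesis h_ge6 : (6 <= h)%N.

Let hR_ge6 : 6 <= hR. Proof. by rewrite ler_nat. Qed.
Let h1_gt0 : 0 < hR - 1. Proof. by move: hR_ge6; lra. Qed.
Let h3_gt0 : 0 < hR - 3. Proof. by move: hR_ge6; lra. Qed.

Lemma weight_ge0 i : 0 <= weight i.
Proof.
by case: i => [a|[a b]] /=; rewrite ?divr_ge0 ?mulr_ge0 ?ler0n ?(ltW h1_gt0) ?(ltW h3_gt0).
Qed.

Lemma lopsided_occurrences i (S : {set obstruction}) :
    (forall j, j \in S -> ~~ conflict i j) ->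
  #|(occurrences i :&: avoid occurrences S)|%:R
    <= weight i * #|avoid occurrences S|%:R.
Proof.
move=> cS; set E := avoid _ _.
have st x y := @avoid_stable i S x y cS; rewrite -/E in st.
have cardH : #|half_edge d| = h := card_half_edge d.
case: i {cS} st => [a|[a b]] /= st.
  case sa: (same_vertex a); last first.
    have -> : (occurrences (inl a) :&: E = set0).
      by apply/setP => c; rewrite !inE /= sa.
    by rewrite cards0 !mul0r.
  have -> : (occurrences (inl a) :&: E = [set c in E | paired c a.1 a.2]).
    by apply/setP => c; rewrite !inE /= sa /= andbC.
  rewrite mul1r mulrC ler_pdivlMr // mulrC.
  have /card_pair : stable E a.1 a.2 by apply: st; rewrite !inE eqxx ?orbT.
  by rewrite cardH -(ler_nat R) natrM natrB // (leq_trans _ h_ge6).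
have w0 : 0 <= (same_vertex a)%:R * (same_vertex b)%:R / ((hR - 1) * (hR - 3)).
  exact: (weight_ge0 (inr (a, b))).
case: (boolP [&& same_vertex a, same_vertex b & a.2 \notin [set a.1; b.1]]); last first.
  move=> nab; suff -> : (occurrences (inr (a, b)) :&: E = set0).
    by rewrite cards0 mulr_ge0.
  apply/setP => c; rewrite !inE /=; apply: contraNF nab => /andP[/and4P[/andP[-> ->] + _ _] _].
  by rewrite !inE.
case/and3P => sa sb nab.
have -> : (occurrences (inr (a, b)) :&: E =
    [set c in E | paired c a.1 b.1 && paired c a.2 b.2]).
  by apply/setP => c; rewrite !inE /= sa sb /= andbC; move: nab; rewrite !inE => ->.
rewrite sa sb mulr1 mul1r mulrC ler_pdivlMr ?mulr_gt0 // mulrC.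
move: nab; rewrite in_set2 negb_or => /andP[n1 n2].
have st1 : stable E a.1 b.1 by apply: st; rewrite !inE eqxx ?orbT.
have st2 : stable E a.2 b.2 by apply: st; rewrite !inE eqxx ?orbT.
have := card_pair2 st1 st2 n1 n2.
by rewrite cardH -(ler_nat R) !natrM !natrB // (leq_trans _ h_ge6).
Qed.

Lemma sum_weight :
  \sum_i weight i = QR / (hR - 1) + QR ^+ 2 / ((hR - 1) * (hR - 3)).
Proof.
rewrite big_sumType; congr (_ + _).
  by rewrite -mulr_suml -natr_sum sum_same_vertex.
transitivity (\sum_a \sum_b weight (inr (a, b))).
  by rewrite pair_bigA; apply: eq_bigr => -[].
rewrite /=; under eq_bigr => a _ do rewrite -mulr_suml -mulr_sumr -natr_sum sum_same_vertex.
by rewrite -!mulr_suml -natr_sum sum_same_vertex expr2.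
Qed.

Lemma sum_weight_at u :
  \sum_i (u \in support i)%:R * weight i <=
  2 * (d (tag u))%:R / (hR - 1) + 4 * (d (tag u))%:R * QR / ((hR - 1) * (hR - 3)).
Proof.
have sumu : \sum_a (u \in [set a.1; a.2])%:R * (same_vertex a)%:R <= 2 * (d (tag u))%:R :> R.
  by under eq_bigr => a _ do rewrite -natrM; rewrite -natr_sum -natrM ler_nat sum_same_vertex_at.
rewrite big_sumType; apply: lerD.
  rewrite /=; under eq_bigr => a _ do rewrite mulrA.
  by rewrite -mulr_suml ler_pM2r ?invr_gt0.
have -> : \sum_p (u \in support (inr p))%:R * weight (inr p) =
    \sum_a \sum_b (u \in support (inr (a, b)))%:R * weight (inr (a, b)).
  by rewrite pair_bigA; apply: eq_bigr => -[].
rewrite /=; under eq_bigr => a _ do under eq_bigr => b _ do rewrite mulrA.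
under eq_bigr => a _ do rewrite -mulr_suml.
rewrite -mulr_suml ler_pM2r ?invr_gt0 ?mulr_gt0 //.
pose f a : R := (u \in [set a.1; a.2])%:R * (same_vertex a)%:R.
pose s a : R := (same_vertex a)%:R.
have sumQ : \sum_a s a = QR by rewrite -natr_sum sum_same_vertex.
apply: (@le_trans _ _ (\sum_a \sum_b (f a * s b + s a * f b))).
  apply: ler_sum => a _; apply: ler_sum => b _.
  have -> : f a * s b + s a * f b = ((u \in [set a.1; a.2])%:R +
      (u \in [set b.1; b.2])%:R) * (s a * s b) by rewrite /f /s; ring.
  rewrite ler_wpM2r ?mulr_ge0 ?ler0n // -natrD ler_nat in_setU.
  by case: (u \in _); case: (u \in _).
under eq_bigr => a _ do rewrite big_split /= -!mulr_sumr sumQ.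
rewrite big_split /= -!mulr_suml sumQ.
have -> : 4 * (d (tag u))%:R * QR = 2 * (d (tag u))%:R * QR + QR * (2 * (d (tag u))%:R) by ring.
by apply: lerD; [apply: ler_wpM2r | apply: ler_wpM2l].
Qed.

Variable C : R.
Hypothesis C_ge0 : 0 <= C.
Hypothesis Q_le : QR <= C * hR.
Hypothesis h_large : (64 * (1 + 4 * C)) ^+ 2 * C <= hR.

(** Since [d v ^ 2 <= Q <= C h], no degree exceeds [sqrt (C h)], which is
    negligible compared with [h]; the constant is the one that [sum_conflict]
    needs. *)
Lemma deg_le v : 64 * (1 + 4 * C) * (d v)%:R <= hR.
Proof.
have h0 : 0 <= hR by exact: ler0n.
have dQ : (d v)%:R ^+ 2 <= QR :> R by rewrite -natrX ler_nat sq_deg_le.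
rewrite -(@ler_pXn2r _ 2) ?nnegrE //; last by rewrite !mulr_ge0 ?ler0n ?addr_ge0 ?mulr_ge0.
rewrite exprMn; apply: (@le_trans _ _ ((64 * (1 + 4 * C)) ^+ 2 * (C * hR))).
  by apply: ler_wpM2l; [exact: sqr_ge0 | exact: le_trans Q_le].
by rewrite mulrA expr2 ler_wpM2r.
Qed.

Lemma inv_h1 : (hR - 1)^-1 <= 2 / hR.
Proof.
rewrite ler_pdivlMr ?(lt_le_trans _ hR_ge6)// mulrC ler_pdivrMr //; move: hR_ge6; lra.
Qed.

Lemma Q_div1 : QR / (hR - 1) <= 2 * C.
Proof.
rewrite ler_pdivrMr //; apply: le_trans Q_le _; rewrite -mulrA mulrCA ler_wpM2l //.
by move: hR_ge6; lra.
Qed.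

Lemma Q_div3 : QR / (hR - 3) <= 2 * C.
Proof.
rewrite ler_pdivrMr //; apply: le_trans Q_le _; rewrite -mulrA mulrCA ler_wpM2l //.
by move: hR_ge6; lra.
Qed.

(** An obstruction has at most four half-edges, and the obstructions through one
    half-edge have total weight [O(d v / h)]: at most [1 / 16] as [h] is large. *)
Lemma sum_conflict i : \sum_(j | conflict i j) weight j <= 4^-1.
Proof.
have h0 : 0 < hR by exact: lt_le_trans hR_ge6.
have at_u u : \sum_j (u \in support j)%:R * weight j <= 16^-1.
  apply: le_trans (sum_weight_at u) _; set m : R := (d (tag u))%:R.
  have m0 : 0 <= m by exact: ler0n.
  have -> : 2 * m / (hR - 1) + 4 * m * QR / ((hR - 1) * (hR - 3)) =
      2 * m / (hR - 1) * (1 + 2 * (QR / (hR - 3))).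
    by field; rewrite !gt_eqF.
  apply: (@le_trans _ _ (2 * m * (2 / hR) * (1 + 2 * (2 * C)))).
    apply: ler_pM.
    - by rewrite divr_ge0 ?mulr_ge0 ?(ltW h1_gt0).
    - by apply: addr_ge0 => //; apply: mulr_ge0 => //; apply: divr_ge0 => //; exact: ltW.
    - by rewrite ler_wpM2l ?mulr_ge0 ?inv_h1.
    - by rewrite lerD2l ler_wpM2l ?Q_div3.
  have -> : 2 * m * (2 / hR) * (1 + 2 * (2 * C)) = (64 * (1 + 4 * C) * m) / hR / 16.
    by field; rewrite gt_eqF.
  by rewrite ler_pdivrMr // mulVf // ler_pdivrMr // mul1r deg_le.
have card4 : (#|support i| <= 4)%N.
  case: i => [a|[a b]] /=; first by rewrite cards2; case: (_ != _).
  by apply: leq_trans (leq_card_setU _ _) _; rewrite !cards2; do 2 case: (_ != _).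
apply: (@le_trans _ _ (\sum_(u in support i) \sum_j (u \in support j)%:R * weight j)).
  rewrite exchange_big /= [leLHS]big_mkcond /=; apply: ler_sum => j _.
  rewrite -mulr_suml; case: ifP => [|_]; last by rewrite mulr_ge0 ?sumr_ge0 ?weight_ge0.
  rewrite /conflict -setI_eq0 => /set0Pn[u]; rewrite in_setI => /andP[ui uj].
  rewrite ler_peMl ?weight_ge0 // (bigD1 u) //= uj lerDl sumr_ge0 //.
apply: (@le_trans _ _ (\sum_(u in support i) 16^-1)); first exact: ler_sum.
rewrite sumr_const -mulr_natl.
have : (#|support i|%:R : R) <= 4 by rewrite ler_nat.
lra.
Qed.

(** The exponent is four times the bound [2 C + (2 C) ^ 2] on the total weight. *)
Theorem prob_simple_ge : ~~ odd h -> expR (- (8 * C + 16 * C ^+ 2)) <= prob_simple R d.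
Proof.
move=> even.
have T0 : (0 < #|T|)%N by apply: configuration_ex; rewrite card_half_edge.
rewrite /prob_simple /equiprob ler_pdivlMr ?ltr0n //.
apply: (@le_trans _ _ #|avoid occurrences [set i in index_enum obstruction]|%:R).
  apply: le_trans (local_lemma weight_ge0 conflict_refl lopsided_occurrences
    sum_conflict (index_enum_uniq _)).
  rewrite ler_wpM2r // ler_expR lerN2 sum_weight.
  have Q0 : 0 <= QR by exact: ler0n.
  have -> : QR / (hR - 1) + QR ^+ 2 / ((hR - 1) * (hR - 3)) =
     QR / (hR - 1) + QR / (hR - 1) * (QR / (hR - 3)) by field; rewrite !gt_eqF.
  have : QR / (hR - 1) * (QR / (hR - 3)) <= 2 * C * (2 * C).
    by apply: ler_pM; rewrite ?divr_ge0 ?Q_div1 ?Q_div3 ?(ltW h1_gt0) ?(ltW h3_gt0).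
  have := Q_div1; lra.
rewrite ler_nat; apply: subset_leq_card; apply/subsetP => c /bigcapP av.
rewrite inE; apply: simple_of_no_obstruction => i.
by have := av i; rewrite !inE mem_index_enum => /(_ isT).
Qed.

End LowerBound.
End Obstructions.

(** * The upper bound: second moment of the number of loops *)

Section UpperBound.
Variables (n : nat) (d : 'I_n -> nat).
Local Notation H := (half_edge d).
Local Notation T := (configuration d).
Local Notation h := (\sum_i d i).
Local Notation Q := (sum_sq_deg d).
Implicit Types (c : T) (x y z u : H) (a b : H * H).

Definition loop_pair a : bool := same_vertex a && (a.1 != a.2).

Definition num_loop_pairs : nat := \sum_(a : H * H) loop_pair a.
Local Notation L := num_loop_pairs.

Lemma num_loop_pairsE : L + h = Q.
Proof.
rewrite -sum_same_vertex -(card_half_edge d) -sum1_card.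
have -> : \sum_(x : H) 1 = \sum_(a : H * H) (a.1 == a.2 : nat).
  rewrite -(pair_bigA _ (fun x y : H => x == y : nat)) /=; apply: eq_bigr => x _.
  by rewrite (bigD1 x) //= eqxx big1 // => y; rewrite eq_sym => /negbTE ->.
rewrite -big_split /=; apply: eq_bigr => -[x y] _; rewrite /loop_pair /same_vertex /=.
by case: (eqVneq x y) => [->|_]; rewrite ?eqxx ?andbF ?andbT ?addn0.
Qed.

(** Every loop is counted twice, once for each order of its half-edges. *)
Definition num_loops c : nat := \sum_(a | loop_pair a) paired c a.1 a.2.

Variable R : realType.
Local Open Scope ring_scope.
Local Notation hR := (h%:R : R).
Local Notation LR := (L%:R : R).
Local Notation t := (#|T|%:R : R).
Local Notation N a := #|[set c | paired c a.1 a.2]|.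

Hypothesis h_ge4 : (4 <= h)%N.

Let hR_ge4 : 4 <= hR. Proof. by rewrite ler_nat. Qed.
Let h1_gt0 : 0 < hR - 1. Proof. by move: hR_ge4; lra. Qed.
Let h3_gt0 : 0 < hR - 3. Proof. by move: hR_ge4; lra. Qed.

Lemma stable_all x y : stable [set: T] x y.
Proof. by move=> *; rewrite in_setT. Qed.

Lemma card_pairE a : loop_pair a -> (N a)%:R = t / (hR - 1).
Proof.
case/andP => _ a12; have h1 : (#|H| - 1)%:R = hR - 1 :> R.
  by rewrite card_half_edge natrB // (leq_trans _ h_ge4).
apply: (@mulIf _ (hR - 1)); rewrite ?gt_eqF // mulfVK ?gt_eqF //.
apply: le_anti; rewrite mulrC -h1 -natrM !ler_nat card_pair_ge // andbT.
have := card_pair (@stable_all a.1 a.2); rewrite cardsT.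
by congr (_ * _ <= _)%N; apply: eq_card => c; rewrite !inE.
Qed.

(** Either [b] is [a] up to order, or [b] starts with a half-edge of [a] and the
    two pairs exclude each other, or [card_pair2] applies. *)
Lemma card_two_pairs a b :
  #|[set c | paired c a.1 a.2 && paired c b.1 b.2]|%:R <=
  ((b == a)%:R + (b == (a.2, a.1))%:R) * (N a)%:R + t / ((hR - 1) * (hR - 3)) :> R.
Proof.
have t0 : 0 <= t / ((hR - 1) * (hR - 3)).
  by rewrite divr_ge0 // mulr_ge0 // ltW.
have subN : (#|[set c | paired c a.1 a.2 && paired c b.1 b.2]| <= N a)%N.
  by apply: subset_leq_card; apply/subsetP => c; rewrite !inE => /andP[].
have [bNa|] := boolP ((b == a) || (b == (a.2, a.1))).
  rewrite -[leLHS]addr0 lerD // -natrD -natrM ler_nat; apply: leq_trans subN _.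
  by apply: leq_pmull; case/orP: bNa => ->; rewrite ?addn1.
rewrite negb_or => /andP[/negbTE ba /negbTE baC]; rewrite ba baC addr0 mul0r add0r.
have [bU|] := boolP (b.1 \in [set a.1; a.2]).
  rewrite (_ : [set c | _] = set0) ?cards0 //; apply/setP => c; rewrite !inE.
  apply/negP => /andP[pa pb]; move: bU; rewrite in_set2 => /orP[]/eqP e.
    move: ba; rewrite [b]surjective_pairing [a]surjective_pairing e.
    by rewrite e in pb; rewrite (paired_inj pa pb) eqxx.
  move: baC; rewrite [b]surjective_pairing e.
  by rewrite e in pb; rewrite pairedC in pa; rewrite (paired_inj pa pb) eqxx.
rewrite in_set2 negb_or => /andP[n1 n2].
have := card_pair2 (@stable_all a.1 a.2) (@stable_all b.1 b.2) n1 n2.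
rewrite cardsT card_half_edge -(ler_nat R) !natrM !natrB ?(leq_trans _ h_ge4) // => le.
rewrite ler_pdivlMr ?mulr_gt0 // mulrC; apply: le_trans le.
rewrite ler_wpM2l ?mulr_ge0 ?(ltW h1_gt0) ?(ltW h3_gt0) // ler_nat.
by apply: subset_leq_card; apply/subsetP => c; rewrite !inE.
Qed.

Lemma sum_num_loops : \sum_c (num_loops c)%:R = LR * (t / (hR - 1)).
Proof.
rewrite -natr_sum exchange_big /= natr_sum.
rewrite (eq_bigr (fun=> t / (hR - 1))) => [|a la]; last first.
  by rewrite -(card_pairE la) -sum1dep_card [in RHS]big_mkcond.
by rewrite sumr_const -[LHS]mulr_natl -sum1_card [in LHS]big_mkcond.
Qed.

(** Bounding the number of disjoint loop pairs by [L] costs only a lower order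
    term: the result exceeds the squared mean by a factor [1 + 2 / (h - 3)], apart
    from the diagonal term. *)
Lemma sum_num_loops_sq : \sum_c (num_loops c)%:R ^+ 2 <=
  LR * (2 * (t / (hR - 1)) + LR * (t / ((hR - 1) * (hR - 3)))).
Proof.
have card_loop : #|loop_pair| = L by rewrite -sum1_card big_mkcond.
have -> : \sum_c (num_loops c)%:R ^+ 2 = \sum_(a | loop_pair a) \sum_(b | loop_pair b)
    #|[set c | paired c a.1 a.2 && paired c b.1 b.2]|%:R :> R.
  transitivity (\sum_c \sum_(a | loop_pair a) \sum_(b | loop_pair b)
      (paired c a.1 a.2 && paired c b.1 b.2)%:R : R).
    apply: eq_bigr => c _; rewrite -natrX expnS expn1 big_distrl /= natr_sum.
    apply: eq_bigr => a _; rewrite big_distrr /= natr_sum.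
    by apply: eq_bigr => b _; rewrite mulnb.
  rewrite exchange_big; apply: eq_bigr => a _; rewrite exchange_big; apply: eq_bigr => b _ /=.
  by rewrite -natr_sum -sum1dep_card [in RHS]big_mkcond.
have -> : LR * (2 * (t / (hR - 1)) + LR * (t / ((hR - 1) * (hR - 3)))) =
  \sum_(a | loop_pair a) (2 * (t / (hR - 1)) + LR * (t / ((hR - 1) * (hR - 3)))).
  by rewrite sumr_const -[RHS]mulr_natl card_loop.
apply: ler_sum => a la.
apply: le_trans (ler_sum _ (fun b _ => card_two_pairs a b)) _.
rewrite big_split /= sumr_const card_loop -[X in _ + X]mulr_natl lerD2r.
rewrite -mulr_suml card_pairE // ler_wpM2r ?divr_ge0 ?(ltW h1_gt0) //.
have sum1 e : \sum_(b | loop_pair b) (b == e)%:R <= 1 :> R.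
  rewrite big_mkcond /= (bigD1 e) //= big1 ?addr0 => [|b /negbTE ->]; last by case: ifP.
  by case: ifP; rewrite ?eqxx.
by rewrite big_split /=; have := sum1 a; have := sum1 (a.2, a.1); lra.
Qed.

(** Chebyshev's inequality: a simple configuration has no loop, so there the number
    of loops differs from its mean [mu] by [mu]. *)
Theorem prob_simple_le : (0 < L)%N ->
  prob_simple R d <= 2 * (hR - 1) / LR + 2 / (hR - 3).
Proof.
move=> L_gt0; have L0 : 0 < LR by rewrite ltr0n.
have mu0 : 0 < LR / (hR - 1) by rewrite divr_gt0.
set mu := LR / (hR - 1) in mu0.
pose S : {set T} := [set c | simple_multigraph (config_multigraph c)].
have chebyshev : #|S|%:R * mu ^+ 2 <= t * (2 * mu + mu ^+ 2 * (2 / (hR - 3))).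
  apply: (@le_trans _ _ (\sum_c ((num_loops c)%:R - mu) ^+ 2)).
    rewrite mulr_natl -sumr_const [leLHS]big_mkcond /=; apply: ler_sum => c _.
    case: ifP => [|_]; last exact: sqr_ge0.
    rewrite inE => /no_loop_paired noloop; rewrite /num_loops big1 ?sub0r ?sqrrN //.
    by move=> a /andP[/eqP/noloop/negbTE -> _].
  have -> : \sum_c ((num_loops c)%:R - mu) ^+ 2 = \sum_c (num_loops c)%:R ^+ 2 -
      2 * mu * (\sum_c (num_loops c)%:R) + t * mu ^+ 2.
    have -> : t * mu ^+ 2 = \sum_(c : T) mu ^+ 2 by rewrite sumr_const mulr_natl.
    rewrite mulr_sumr -sumrB -big_split /=.
    by apply: eq_bigr => c _; ring.
  rewrite sum_num_loops; have := sum_num_loops_sq.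
  have -> : LR * (2 * (t / (hR - 1)) + LR * (t / ((hR - 1) * (hR - 3)))) =
     t * (2 * mu + mu ^+ 2 * (1 + 2 / (hR - 3))).
    by rewrite /mu; field; rewrite !gt_eqF.
  have -> : LR * (t / (hR - 1)) = t * mu by rewrite /mu; field; rewrite gt_eqF.
  lra.
rewrite /prob_simple /equiprob -/S.
have [t0|] := eqVneq t 0.
  by rewrite t0 invr0 mulr0 addr_ge0 // divr_ge0 ?mulr_ge0 ?(ltW h1_gt0) ?(ltW h3_gt0) ?(ltW L0).
rewrite pnatr_eq0 -lt0n => t0; rewrite ler_pdivrMr ?ltr0n //.
rewrite -(ler_pM2r (exprn_gt0 2 mu0)); apply: le_trans chebyshev _.
rewrite le_eqVlt; apply/orP; left; apply/eqP; rewrite /mu; field.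
by rewrite !gt_eqF.
Qed.

End UpperBound.

(** * Asymptotics *)

Local Open Scope classical_set_scope.
Local Open Scope ring_scope.

Section Sequences.
Variable R : realType.

(** The infima of the tails increase to the lower limit, so the latter is positive
    as soon as one of them is. *)
Lemma limn_einf_gt0P (u : nat -> R) :
  (0 < limn_einf (fun n => (u n)%:E))%E <->
  exists2 e : R, 0 < e & \forall n \near \oo, e <= u n.
Proof.
have lim_sup := @cvg_einfs_sup R (fun n => (u n)%:E).
rewrite limn_einf_lim (cvg_lim (@ereal_hausdorff R) lim_sup); split.
  case/ereal_sup_gt => _ [N _ <-] inf_gt0.
  have infN m : (N <= m)%N -> (einfs (fun n => (u n)%:E) N <= (u m)%:E)%E.
    by move=> Nm; apply: ereal_inf_lbound; exists m.
  move: inf_gt0 infN; case: (einfs _ N) => [r r0 rN|_ /(_ N (leqnn N))|//]; last first.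
    by rewrite leye_eq.
  exists r; first by rewrite -lte_fin.
  by exists N => // m Nm; rewrite -lee_fin; exact: rN.
case=> e e0 [N _ uN]; apply: (@lt_le_trans _ _ e%:E); first by rewrite lte_fin.
apply: le_trans (ereal_sup_ubound _); last by exists N.
by apply: le_ereal_inf_tmp => _ [m /= Nm <-]; rewrite lee_fin; exact: uN.
Qed.

Lemma bigO_natP (a b : nat -> nat) :
  bigO_nat R a b <->
  exists2 k : R, 0 < k & \forall n \near \oo, (a n)%:R <= k * (b n)%:R.
Proof.
rewrite /bigO_nat eqO_exP; split=> -[k k0 le_ab]; exists k => //;
  by move: le_ab; apply: filterS => n; rewrite !normr_nat.
Qed.

Variable d : forall n : nat, 'I_n -> nat.
Hypothesis d_even : forall n, (0 < n)%N -> ~~ odd (\sum_(i < n) d i)%N.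
Hypothesis N_Theta : Theta_nat R (fun n => num_edges (@d n)) (fun n => n).
Local Notation h n := ((\sum_(i < n) d i)%N%:R : R).
Local Notation Q n := ((sum_sq_deg (@d n))%:R : R).
Local Notation P n := (prob_simple R (@d n)).

Lemma half_edges_edges n : (0 < n)%N -> h n = 2 * (num_edges (@d n))%:R.
Proof.
move=> n0; rewrite /num_edges -natrM mul2n.
by have := odd_double_half (\sum_(i < n) d i)%N; rewrite (negbTE (d_even n0)) => {1}<-.
Qed.

Lemma half_edges_le : exists2 k : R, 0 < k & \forall n \near \oo, h n <= k * n%:R.
Proof.
have [/bigO_natP[k k0 Hk] _] := N_Theta; exists (2 * k); first by rewrite mulr_gt0.
near=> n; rewrite half_edges_edges; last by near: n; exact: nbhs_infty_gt.
by rewrite -mulrA ler_pM2l //; near: n.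
Unshelve. all: by end_near. Qed.

Lemma half_edges_ge : exists2 k : R, 0 < k & \forall n \near \oo, n%:R <= k * h n.
Proof.
have [_ /bigO_natP[k k0 Hk]] := N_Theta; exists k => //.
near=> n; rewrite half_edges_edges; last by near: n; exact: nbhs_infty_gt.
apply: (@le_trans _ _ (k * (num_edges (@d n))%:R)); first by near: n.
by rewrite ler_pM2l // ler_peMl // ler1n.
Unshelve. all: by end_near. Qed.

Lemma half_edges_large (A : R) : \forall n \near \oo, A <= h n.
Proof.
have [k k0 Hk] := half_edges_ge; near=> n.
rewrite -(ler_pM2l k0); apply: (@le_trans _ _ n%:R).
  by near: n; exact: nbhs_infty_ger.
by near: n.
Unshelve. all: by end_near. Qed.

Lemma prob_simple_bounded_below (C : R) : 0 <= C ->
  exists2 e : R, 0 < e & \forall n \near \oo, Q n <= C * n%:R -> e <= P n.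
Proof.
move=> C0; have [k k0 Hk] := half_edges_ge; pose C' := C * k.
have C'0 : 0 <= C' by rewrite mulr_ge0 // ltW.
exists (expR (- (8 * C' + 16 * C' ^+ 2))); first exact: expR_gt0.
near=> n => QC; apply: prob_simple_ge => //.
- by rewrite -(ler_nat R); near: n; exact: half_edges_large.
- apply: le_trans QC _; rewrite -mulrA ler_wpM2l //; by near: n.
- by near: n; exact: half_edges_large.
- by apply: d_even; near: n; exact: nbhs_infty_gt.
Unshelve. all: by end_near. Qed.

(** With [Q >= (1 + 4 / e) h] there are at least [4 h / e] loop pairs, and both
    terms of [prob_simple_le] are at most [e / 2] once [h >= 3 + 4 / e]. *)
Lemma prob_simple_small (e : R) : 0 < e ->
  exists2 K : R, 0 < K & \forall n \near \oo, K * n%:R <= Q n -> P n <= e.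
Proof.
move=> e0; have [k k0 Hk] := half_edges_le; have e40 : 0 < 4 / e by rewrite divr_gt0.
exists ((1 + 4 / e) * k); first by rewrite mulr_gt0 // addr_gt0.
near=> n => KQ.
have h4 : 4 <= h n by near: n; exact: half_edges_large.
have h_large : 3 + 4 / e <= h n by near: n; exact: half_edges_large.
have hQ : (1 + 4 / e) * h n <= Q n.
  apply: le_trans KQ; rewrite -mulrA ler_pM2l ?addr_gt0 //; by near: n.
have LE : (num_loop_pairs (@d n))%:R + h n = Q n by rewrite -natrD num_loop_pairsE.
set L : R := (num_loop_pairs _)%:R in LE.
have L_ge : 4 / e * h n <= L by move: hQ; rewrite mulrDl mul1r; lra.
have L_gt0 : 0 < L by apply: lt_le_trans L_ge; rewrite mulr_gt0 //; lra.
apply: le_trans (prob_simple_le _ _ _) _.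
- by rewrite -(ler_nat R).
- by rewrite -(ltr_nat R).
have -> : e = e / 2 + e / 2 by field.
apply: lerD; last first.
  rewrite ler_pdivrMr; last lra.
  have : e / 2 * (4 / e) <= e / 2 * (h n - 3) by rewrite ler_pM2l ?divr_gt0 //; lra.
  have -> : e / 2 * (4 / e) = 2 by field; rewrite gt_eqF.
  by [].
rewrite -/L ler_pdivrMr //.
have : e / 2 * (4 / e * h n) <= e / 2 * L by rewrite ler_pM2l ?divr_gt0.
have -> : e / 2 * (4 / e * h n) = 2 * h n by field; rewrite gt_eqF.
lra.
Unshelve. all: by end_near. Qed.

Lemma liminf_prob_simple :
  (0 < limn_einf (fun n => (P n)%:E))%E <->
  bigO_nat R (fun n => sum_sq_deg (@d n)) (fun n => n).
Proof.
rewrite limn_einf_gt0P bigO_natP; split=> [[e e0 Pe]|[C C0 QC]].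
  have [K K0 HK] : exists2 K : R, 0 < K &
      \forall n \near \oo, K * n%:R <= Q n -> P n <= e / 2.
    by apply: prob_simple_small; rewrite divr_gt0.
  exists K => //; near=> n; rewrite leNgt; apply/negP => /ltW KQ.
  have Pn : e <= P n by near: n.
  have : P n <= e / 2 by move: KQ; near: n.
  lra.
have [e e0 He] := prob_simple_bounded_below (ltW C0).
exists e => //; near=> n.
have QCn : Q n <= C * n%:R by near: n.
by move: QCn; near: n.
Unshelve. all: by end_near. Qed.

Lemma prob_simple_ge0 n : 0 <= P n.
Proof. by rewrite divr_ge0. Qed.

Lemma prob_simple_cvg0 :
  ((fun n => P n) @ \oo --> (0 : R)) <->
  ((fun n => Q n / n%:R) @ \oo --> +oo).
Proof.
rewrite cvgr0Pnorm_le cvgryPge; split=> [P0 A|Qoo e e0].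
  have M_ge0 : 0 <= Num.max A 0 by rewrite le_max lexx orbT.
  have [e e0 He] := prob_simple_bounded_below M_ge0.
  have e2_gt0 : 0 < e / 2 by rewrite divr_gt0.
  have Pe := P0 _ e2_gt0.
  near=> n; have n0 : 0 < n%:R :> R by near: n; exact: nbhs_infty_gtr.
  rewrite leNgt; apply/negP => QA.
  have QM : Q n <= Num.max A 0 * n%:R.
    by rewrite -ler_pdivrMr // (le_trans (ltW QA)) // le_max lexx.
  have eP : e <= P n by move: QM; near: n.
  have : `|P n| <= e / 2 by near: n.
  rewrite ger0_norm ?prob_simple_ge0 //; lra.
have [K K0 HK] := prob_simple_small e0; have QK := Qoo K.
near=> n; rewrite ger0_norm ?prob_simple_ge0 //.
have n0 : 0 < n%:R :> R by near: n; exact: nbhs_infty_gtr.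
have KQ : K * n%:R <= Q n by rewrite -ler_pdivlMr //; near: n.
by move: KQ; near: n.
Unshelve. all: by end_near. Qed.

End Sequences.

Theorem corollary1p2 (R : realType) (d : forall n : nat, 'I_n -> nat)
    (d_even : forall n : nat, (0 < n)%N -> ~~ odd (\sum_(i < n) d n i)%N)
    (N_Theta : Theta_nat R (fun n => num_edges (d n)) (fun n => n)) :
  ((0 < limn_einf (fun n => (prob_simple R (d n))%:E))%E <->
   bigO_nat R (fun n => sum_sq_deg (d n)) (fun n => n)) /\
  (((fun n => prob_simple R (d n)) @ \oo --> (0 : R)) <->
   ((fun n => (sum_sq_deg (d n))%:R / n%:R : R) @ \oo --> +oo)).
Proof.
split; [exact: liminf_prob_simple | exact: prob_simple_cvg0].
Qed.
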